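(* Let $K$ be an algebraically closed field with $\operatorname{char}(K)\neq 2$. Up to isomorphism there exist exactly $13$ nilpotent Jordan algebras of dimension $4$ over $K$: every such algebra is isomorphic to one of the following pairwise non-isomorphic nilpotent Jordan algebras, each with basis $a,b,c,d$ and the indicated nonzero products. Nilpotent Jordan algebras with central component: 1. $J_{4,1}$: all products are zero; 2. $J_{4,2}$: $a^2=b$; 3. $J_{4,3}$: $a^2=c,\ b^2=c$; 4. $J_{4,4}$: $a^2=b,\ a\circ b=c$. Nilpotent Jordan algebras without central component: 5. $J_{4,5}$: $a^2=d,\ b^2=d,\ c^2=d$; 6. $J_{4,6}$: $a^2=b,\ b\circ c=d$; 7. $J_{4,7}$: $a^2=b,\ a\circ b=d,\ c^2=d$; 8. $J_{4,8}$: $a^2=c,\ b^2=c,\ a\circ c=d$; 9. $J_{4,9}$: $a^2=c,\ b^2=-c,\ a\circ c=d,\ b\circ c=d$; 10. $J_{4,10}$: $a^2=c,\ b^2=-c,\ a\circ c=d,\ b\circ c=d,\ a\circ b=d$; 11. $J_{4,11}$: $a^2=b,\ a\circ b=c,\ a\circ c=d,\ b^2=d$; 12. $J_{4,12}$: $a^2=c,\ a\circ b=d$; 13. $J_{4,13}$: $a^2=c,\ b^2=c,\ a\circ b=d$.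
   Context: A Jordan algebra over a field $K$ is a $K$-vector space $J$ with a symmetric bilinear product $\circ:J\times J\to J$ satisfying $x^2\circ(x\circ y)=x\circ(x^2\circ y)$ for all $x,y\in J$, where $x^2=x\circ x$. Set $c^1(J)=J$ and $c^m(J)=c^{m-1}(J)\circ J$ (the span of the products) for $m\geq 2$; $J$ is nilpotent if $c^n(J)=0$ for some $n$. The centre is $Z(J)=\{x\in J: x\circ y=0\ \forall y\in J\}$. $J$ has a central component if $J=I_1\oplus I_2$ is a direct sum of two ideals with $I_2$ nonzero and contained in $Z(J)$. In the multiplication tables, all products of basis vectors that are not listed (and do not follow from commutativity) are zero. *)

(* Defs.v *)
From HB Require Import structures.
From mathcomp Require Import all_boot all_order all_algebra.

Set Implicit Arguments.
Unset Strict Implicit.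
Unset Printing Implicit Defensive.

Import GRing.Theory.
Local Open Scope ring_scope.

(* A (finite-dimensional, not necessarily associative or unital) K-algebra is
   given by a vectType J over K and a bilinear product mul on J. *)
Section Algebras.
Variables (K : fieldType) (J : vectType K) (mul : {bilinear J -> J -> J}).

Definition is_jordan : Prop :=
  commutative mul /\
  forall x y : J, mul (mul x x) (mul x y) = mul x (mul (mul x x) y).

(* The span of all mul u v with u in U and v in V; see prodsp_min. *)
Definition prodsp (U V : {vspace J}) : {vspace J} :=
  <<[seq mul u v | u <- vbasis U, v <- vbasis V]>>%VS.

Lemma memv_prodsp (U V : {vspace J}) u v :
  u \in U -> v \in V -> mul u v \in prodsp U V.
Proof.
move=> /coord_vbasis-> /coord_vbasis->.
rewrite linear_sumlz; apply: memv_suml => i _.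
rewrite linear_sumr; apply: memv_suml => j _.
rewrite linearZl_LR linearZr_LR !memvZ // memv_span //.
by apply/allpairsP; exists ((vbasis U)`_i, (vbasis V)`_j); rewrite !memt_nth.
Qed.

Lemma prodsp_min (U V W : {vspace J}) :
  (forall u v, u \in U -> v \in V -> mul u v \in W) <-> (prodsp U V <= W)%VS.
Proof.
split=> [sUVW | sUVW u v Uu Vv]; last first.
  exact: subvP sUVW _ (memv_prodsp Uu Vv).
apply/span_subvP => _ /allpairsP[[u v] /= [Uu Vv ->]].
by rewrite sUVW ?vbasis_mem.
Qed.

(* cpow m is c^m(J) for m >= 1; cpow 0 is also J. *)
Definition cpow (m : nat) : {vspace J} :=
  iter m.-1 (fun U => prodsp U fullv) fullv.

Definition is_nilpotent : Prop := exists n, cpow n = 0%VS.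

Definition in_centre (x : J) : Prop := forall y : J, mul x y = 0.

Definition is_ideal (I : {vspace J}) : Prop :=
  forall x y : J, x \in I -> mul x y \in I /\ mul y x \in I.

Definition has_central_component : Prop :=
  exists I1 I2 : {vspace J},
    [/\ is_ideal I1 /\ is_ideal I2,
        (I1 + I2 = fullv)%VS /\ directv (I1 + I2)%VS,
        I2 <> 0%VS
      & forall x, x \in I2 -> in_centre x].

End Algebras.

Definition isomorphic (K : fieldType) (J1 J2 : vectType K)
    (mul1 : {bilinear J1 -> J1 -> J1}) (mul2 : {bilinear J2 -> J2 -> J2}) :
    Prop :=
  exists f : {linear J1 -> J2},
    bijective f /\ {morph f : x y / mul1 x y >-> mul2 x y}.

(* A multiplication table on K^4 lists entries (i, j, w) meaning
   e_i o e_j = e_j o e_i = w; products not listed are 0. *)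
Definition table (K : fieldType) : Type := seq ('I_4 * 'I_4 * 'rV[K]_4).

Section TableAlgebra.
Variables (K : fieldType) (t : table K).

(* A sum rather than a lookup; a table lists each unordered pair once. *)
Definition tabprod (i j : 'I_4) : 'rV[K]_4 :=
  \sum_(p <- t | (p.1 == (i, j)) || (p.1 == (j, i))) p.2.

Definition tabmul (x y : 'rV[K]_4) : 'rV[K]_4 :=
  \sum_i \sum_j (x 0 i * y 0 j) *: tabprod i j.

Lemma tabmul_bilinear : bilinear_for *:%R *:%R tabmul.
Proof.
split=> u k v w; rewrite /tabmul /= scaler_sumr -big_split /=;
  apply: eq_bigr => i _; rewrite scaler_sumr -big_split /=;
  apply: eq_bigr => j _; rewrite !mxE scalerA -scalerDl; congr (_ *: _).
  by rewrite mulrDl mulrA.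
by rewrite mulrDr mulrCA.
Qed.

HB.instance Definition _ := bilinear_isBilinear.Build K
  'rV[K]_4 'rV[K]_4 'rV[K]_4 *:%R *:%R tabmul tabmul_bilinear.

Lemma tabmul_delta (i j : 'I_4) : tabmul 'e_i 'e_j = tabprod i j.
Proof.
rewrite /tabmul (bigD1 i) //= [X in _ + X]big1 => [|k ki]; last first.
  by rewrite big1 // => l _; rewrite mxE (negPf ki) mul0r scale0r.
rewrite (bigD1 j) //= [X in _ + X + _]big1 => [|l lj]; last first.
  by rewrite !mxE (negPf lj) mulr0 scale0r.
by rewrite !mxE !eqxx mulr1 scale1r !addr0.
Qed.

End TableAlgebra.

Definition J4_tables (K : fieldType) : 13.-tuple (table K) :=
  let a := Ordinal (isT : (0 < 4)%N) in
  let b := Ordinal (isT : (1 < 4)%N) in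
  let c := Ordinal (isT : (2 < 4)%N) in
  let d := Ordinal (isT : (3 < 4)%N) in
  [tuple
     [::];
     [:: (a, a, 'e_b)];
     [:: (a, a, 'e_c); (b, b, 'e_c)];
     [:: (a, a, 'e_b); (a, b, 'e_c)];
     [:: (a, a, 'e_d); (b, b, 'e_d); (c, c, 'e_d)];
     [:: (a, a, 'e_b); (b, c, 'e_d)];
     [:: (a, a, 'e_b); (a, b, 'e_d); (c, c, 'e_d)];
     [:: (a, a, 'e_c); (b, b, 'e_c); (a, c, 'e_d)];
     [:: (a, a, 'e_c); (b, b, - 'e_c); (a, c, 'e_d); (b, c, 'e_d)];
     [:: (a, a, 'e_c); (b, b, - 'e_c); (a, c, 'e_d); (b, c, 'e_d);
         (a, b, 'e_d)];
     [:: (a, a, 'e_b); (a, b, 'e_c); (a, c, 'e_d); (b, b, 'e_d)];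
     [:: (a, a, 'e_c); (a, b, 'e_d)];
     [:: (a, a, 'e_c); (b, b, 'e_c); (a, b, 'e_d)]].

(* J4 K i is the algebra J_{4,i+1}: the index i : 'I_13 starts at 0. *)
Definition J4 (K : fieldType) (i : 'I_13) :
    {bilinear 'rV[K]_4 -> 'rV[K]_4 -> 'rV[K]_4} :=
  tabmul (tnth (J4_tables K) i).

(* Main.v *)
Require Import Defs.
From HB Require Import structures.
From mathcomp Require Import all_boot all_order all_algebra.
From mathcomp Require Import ring.

(* In a nilpotent algebra every proper subspace F admits x outside F with x J
   inside F; climbing from 0 this gives a basis e_0, ..., e_3 in which the
   product is strictly triangular, hence given by ten structure constants.
   If e_0^2 has a component along e_1, then e_1 may be taken to be e_0^2.
   Otherwise e_0, e_1 span a space V carrying a quadratic form with values in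
   J / <e_3>. If it vanishes, all products lie on a line and one diagonalizes a
   ternary form. If it has rank 1 one is back in the previous case. If it has
   rank 2, the cases are told apart by the linear form l on V defined by
   v o e_2 = l(v) e_3, according to whether l is zero, anisotropic or isotropic.
   The Jordan identity is only used to eliminate structure constants.

   Non-isomorphism is detected by first-order properties of the product. For a
   nilpotent algebra, having a central component means that the centre is not
   contained in J^2; in the nine algebras without central component, moreover,
   every central element is a single product. *)

Set Implicit Arguments.
Unset Strict Implicit.
Unset Printing Implicit Defensive.

Import GRing.Theory.
Local Open Scope ring_scope.

(** * Coordinates on [K^4] and the thirteen tables in triangular form *)

Section Coordinates.
Variable K : fieldType.

Definition vec4 (x0 x1 x2 x3 : K) : 'rV[K]_4 :=
  \row_(j < 4) nth 0 [:: x0; x1; x2; x3] j.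

Lemma vec4P (P : 'rV[K]_4 -> Prop) :
  (forall x0 x1 x2 x3, P (vec4 x0 x1 x2 x3)) -> forall x, P x.
Proof.
move=> Pvec x; suff ->: x = vec4 (x 0 (inord 0)) (x 0 (inord 1))
                               (x 0 (inord 2)) (x 0 (inord 3)) by [].
apply/rowP => j; rewrite mxE.
by case: j => [[|[|[|[|//]]]] j4] /=; congr (x 0 _); apply/val_inj;
  rewrite /= inordK.
Qed.

Lemma vec4_inj x0 x1 x2 x3 y0 y1 y2 y3 :
  vec4 x0 x1 x2 x3 = vec4 y0 y1 y2 y3 ->
  [/\ x0 = y0, x1 = y1, x2 = y2 & x3 = y3].
Proof.
move/rowP => eq_xy; split.
- by move/(_ (inord 0)): eq_xy; rewrite !mxE inordK.
- by move/(_ (inord 1)): eq_xy; rewrite !mxE inordK.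
- by move/(_ (inord 2)): eq_xy; rewrite !mxE inordK.
- by move/(_ (inord 3)): eq_xy; rewrite !mxE inordK.
Qed.

Lemma vec4_0 : 0 = vec4 0 0 0 0.
Proof. by apply/rowP; case=> [[|[|[|[|//]]]] j4]; rewrite !mxE. Qed.

Lemma vec4D x0 x1 x2 x3 y0 y1 y2 y3 :
  vec4 x0 x1 x2 x3 + vec4 y0 y1 y2 y3 =
  vec4 (x0 + y0) (x1 + y1) (x2 + y2) (x3 + y3).
Proof. by apply/rowP; case=> [[|[|[|[|//]]]] j4]; rewrite !mxE. Qed.

Lemma vec4Z k x0 x1 x2 x3 :
  k *: vec4 x0 x1 x2 x3 = vec4 (k * x0) (k * x1) (k * x2) (k * x3).
Proof. by apply/rowP; case=> [[|[|[|[|//]]]] j4]; rewrite !mxE. Qed.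

Lemma vec4N x0 x1 x2 x3 :
  - vec4 x0 x1 x2 x3 = vec4 (- x0) (- x1) (- x2) (- x3).
Proof. by apply/rowP; case=> [[|[|[|[|//]]]] j4]; rewrite !mxE. Qed.

Lemma delta_vec4 (i : 'I_4) :
  'e_i = vec4 (i == 0 :> nat)%:R (i == 1 :> nat)%:R
              (i == 2 :> nat)%:R (i == 3 :> nat)%:R.
Proof.
by apply/rowP => j; rewrite !mxE eq_sym; case: j => [[|[|[|[|//]]]] j4].
Qed.

Definition mat4 (r0 r1 r2 r3 : 'rV[K]_4) : 'M[K]_4 :=
  \matrix_(i < 4) nth 0 [:: r0; r1; r2; r3] i.

Lemma vec4_mulmx x0 x1 x2 x3 r0 r1 r2 r3 :
  vec4 x0 x1 x2 x3 *m mat4 r0 r1 r2 r3 =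
  x0 *: r0 + x1 *: r1 + x2 *: r2 + x3 *: r3.
Proof.
by rewrite mulmx_sum_row !big_ord_recl big_ord0 !mxE !rowK /= addr0 !addrA.
Qed.

(* The commutative product with e_0 e_0 = p1 e_1 + p2 e_2 + p3 e_3,
   e_0 e_1 = q2 e_2 + q3 e_3, e_1 e_1 = r2 e_2 + r3 e_3, e_0 e_2 = s e_3,
   e_1 e_2 = t e_3, e_2 e_2 = u e_3 and e_3 central. *)
Definition trimul (p1 p2 p3 q2 q3 r2 r3 s t u : K) (x y : 'rV[K]_4) :=
  let x0 := x 0 (inord 0) in let x1 := x 0 (inord 1) in
  let x2 := x 0 (inord 2) in
  let y0 := y 0 (inord 0) in let y1 := y 0 (inord 1) in
  let y2 := y 0 (inord 2) in
  let z01 := x0 * y1 + x1 * y0 in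
  vec4 0 (p1 * (x0 * y0))
    (p2 * (x0 * y0) + q2 * z01 + r2 * (x1 * y1))
    (p3 * (x0 * y0) + q3 * z01 + r3 * (x1 * y1) + s * (x0 * y2 + x2 * y0) +
     t * (x1 * y2 + x2 * y1) + u * (x2 * y2)).

Lemma trimulE p1 p2 p3 q2 q3 r2 r3 s t u x0 x1 x2 x3 y0 y1 y2 y3 :
  trimul p1 p2 p3 q2 q3 r2 r3 s t u (vec4 x0 x1 x2 x3) (vec4 y0 y1 y2 y3) =
  vec4 0 (p1 * (x0 * y0))
    (p2 * (x0 * y0) + q2 * (x0 * y1 + x1 * y0) + r2 * (x1 * y1))
    (p3 * (x0 * y0) + q3 * (x0 * y1 + x1 * y0) + r3 * (x1 * y1) +
     s * (x0 * y2 + x2 * y0) + t * (x1 * y2 + x2 * y1) + u * (x2 * y2)).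
Proof. by rewrite /trimul !mxE !inordK. Qed.

Definition J4mul : seq ('rV[K]_4 -> 'rV[K]_4 -> 'rV[K]_4) :=
  [:: trimul 0 0 0 0 0 0    0 0 0 0;
      trimul 1 0 0 0 0 0    0 0 0 0;
      trimul 0 1 0 0 0 1    0 0 0 0;
      trimul 1 0 0 1 0 0    0 0 0 0;
      trimul 0 0 1 0 0 0    1 0 0 1;
      trimul 1 0 0 0 0 0    0 0 1 0;
      trimul 1 0 0 0 1 0    0 0 0 1;
      trimul 0 1 0 0 0 1    0 1 0 0;
      trimul 0 1 0 0 0 (-1) 0 1 1 0;
      trimul 0 1 0 0 1 (-1) 0 1 1 0;
      trimul 1 0 0 1 0 0    1 1 0 0;
      trimul 0 1 0 0 1 0    0 0 0 0;
      trimul 0 1 0 0 1 1    0 0 0 0].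

(** Exchanging the sums isolates one table entry; it is met by one ordered pair of indices if it is
    a square and by two otherwise. *)
Lemma tabmulE (t : table K) x y :
  tabmul t x y =
  \sum_(p <- t) (if p.1.1 == p.1.2 then x 0 p.1.1 * y 0 p.1.1
                 else x 0 p.1.1 * y 0 p.1.2 + x 0 p.1.2 * y 0 p.1.1) *: p.2.
Proof.
rewrite /tabmul /tabprod.
under eq_bigr => i _ do under eq_bigr => j _ do
  rewrite scaler_sumr big_mkcond /=.
under eq_bigr => i _ do rewrite exchange_big /=.
rewrite exchange_big /=; apply: eq_bigr => -[[k l] w] _ /=.
under eq_bigr => i _ do rewrite -big_mkcond -scaler_suml /=.
rewrite -scaler_suml; congr (_ *: _).
rewrite pair_big_dep /=.
case: eqP => [<- | /eqP kl].
  rewrite (eq_bigl (pred1 (k, k))) ?big_pred1_eq // => -[i j] /=.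
  by rewrite /= !xpair_eqE ![_ == k]eq_sym andbC orbb andbC.
rewrite (bigD1 (k, l)) ?eqxx //=; congr (_ + _).
rewrite (eq_bigl (pred1 (l, k))) ?big_pred1_eq // => -[i j] /=.
rewrite /= !xpair_eqE ![_ == k]eq_sym ![_ == l]eq_sym.
by case: (k =P i) => [<-|]; case: (l =P j) => [<-|];
  rewrite ?eqxx ?andbT ?andbF ?orbF //=
  ?(negPf kl) ?[l == k]eq_sym ?(negPf kl) //=; rewrite andbC.
Qed.

Lemma J4E (i : 'I_13) x y : J4 K i x y = nth (fun _ _ => 0) J4mul i x y.
Proof.
elim/vec4P: x => x0 x1 x2 x3; elim/vec4P: y => y0 y1 y2 y3.
case: i; do 13?[case=> [i13|]] => //;
rewrite -[LHS]/(tabmul (tnth (J4_tables K) _) _ _) tabmulE (tnth_nth [::]);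
rewrite /= trimulE ?big_cons big_nil /= ?delta_vec4 ?mxE /= vec4_0;
by rewrite ?vec4N ?vec4Z ?vec4D; congr (vec4 _ _ _ _); ring.
Qed.

End Coordinates.

(** * Structure constants of an abstract algebra and change of basis *)

Section Models.
Variables (K : fieldType) (J : vectType K) (mul : {bilinear J -> J -> J}).

Definition modelled_by (B : 'rV[K]_4 -> 'rV[K]_4 -> 'rV[K]_4) : Prop :=
  exists g : 'rV[K]_4 -> J,
    [/\ linear g, bijective g & forall x y, mul (g x) (g y) = g (B x y)].

Lemma nilpotent_step (F : {vspace J}) :
  is_nilpotent mul -> F != fullv ->
  exists2 x, x \notin F & forall y, mul x y \in F.
Proof.
move=> [n cpow_n] Fproper.
have exF : exists n, (cpow mul n <= F)%VS by exists n; rewrite cpow_n sub0v.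
(* For the least power of [J] inside [F], any [x] in the previous power but outside [F] works. The
   exponents 0 and 1 both give [J], which is not inside [F]. *)
case: (ex_minnP exF) => -[|[|m]] sub_m min_m.
- by case/negP: Fproper; rewrite eqEsubv subvf.
- by case/negP: Fproper; rewrite eqEsubv subvf.
have /subvPn[x x_m xF] : ~~ (cpow mul m.+1 <= F)%VS.
  by apply/negP => /min_m; rewrite ltnn.
exists x => // y; apply: (subvP sub_m); exact: memv_prodsp (memvf y).
Qed.

Lemma nilpotent_trimul :
  commutative mul -> is_nilpotent mul -> \dim {: J} = 4%N ->
  exists p1 p2 p3 q2 q3 r2 r3 s t u,
    modelled_by (trimul p1 p2 p3 q2 q3 r2 r3 s t u).
Proof.
move=> mulC nilJ dimJ.
have step (X : seq J) : free X -> (size X < 4)%N ->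
    exists2 x, free (x :: X) & forall y, mul x y \in <<X>>%VS.
  move=> freeX szX; have [|x xX mulx] := @nilpotent_step <<X>>%VS nilJ.
    apply: contraTneq szX => spanX; move/eqP: freeX.
    by rewrite spanX dimJ => <-.
  by exists x; rewrite ?free_cons ?xX.
(* The vectors are found from last to first. With [mulC], the product of e_i and e_j for i <= j lies
   in the span of the vectors after e_j: 3 + 2 + 2 + 1 + 1 + 1 constants. *)
have [e3 free3 mul3] := step [::] (nil_free _) isT.
have [e2 free2 mul2] := step _ free3 isT.
have [e1 free1 mul1] := step _ free2 isT.
have [e0 free0 mul0] := step _ free1 isT.
pose X := [tuple e0; e1; e2; e3].
have basisX : basis_of fullv X by rewrite basisEfree free0 subvf dimJ.
pose g (x : 'rV[K]_4) := \sum_(i < 4) x 0 i *: X`_i.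
have lin_g : linear g.
  move=> k x y; rewrite /g scaler_sumr -big_split; apply: eq_bigr => i _.
  by rewrite !mxE scalerDl scalerA.
have g0 : g 0 = 0 by rewrite /g big1 // => i _; rewrite mxE scale0r.
have gE a b c d : g (vec4 a b c d) = a *: e0 + (b *: e1 + (c *: e2 + d *: e3)).
  by rewrite /g !big_ord_recl big_ord0 !mxE /= addr0.
have in3 v : v \in <<[:: e3]>>%VS -> exists d, v = g (vec4 0 0 0 d).
  rewrite span_seq1 => /vlineP[d ->]; exists d.
  by rewrite gE !scale0r !add0r.
have in2 v : v \in <<[:: e2; e3]>>%VS -> exists c d, v = g (vec4 0 0 c d).
  rewrite span_cons => /memv_addP[_ /vlineP[c ->] [w /in3[d ->] ->]].
  by exists c, d; rewrite !gE !scale0r !add0r.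
have in1 v : v \in <<[:: e1; e2; e3]>>%VS -> exists b c d, v = g (vec4 0 b c d).
  rewrite span_cons => /memv_addP[_ /vlineP[b ->] [w /in2[c [d ->]] ->]].
  by exists b, c, d; rewrite !gE !scale0r !add0r.
have [p1 [p2 [p3 e00]]] := in1 _ (mul0 e0).
have [q2 [q3 e10]] := in2 _ (mul1 e0); have [r2 [r3 e11]] := in2 _ (mul1 e1).
have [s e20] := in3 _ (mul2 e0); have [t e21] := in3 _ (mul2 e1).
have [u e22] := in3 _ (mul2 e2).
have e3_ y : mul e3 y = g (vec4 0 0 0 0).
  by move: (mul3 y); rewrite span_nil memv0 -vec4_0 g0 => /eqP.
exists p1, p2, p3, q2, q3, r2, r3, s, t, u, g; split=> //.
  exists (fun v => \row_i coord X i v) => [x | v].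
    apply/rowP => i; rewrite mxE linear_sum (bigD1 i) //= big1 => [|j ji].
      by rewrite linearZ /= coord_free // eqxx mulr1 addr0.
    by rewrite linearZ /= coord_free // (negPf ji) mulr0.
  rewrite [RHS](coord_basis basisX (memvf v)).
  by apply: eq_bigr => i _; rewrite mxE.
have gD x y : g (x + y) = g x + g y by have := lin_g 1 x y; rewrite !scale1r.
have gZ k x : g (k *: x) = k *: g x by have := lin_g k x 0; rewrite g0 !addr0.
elim/vec4P=> x0 x1 x2 x3; elim/vec4P=> y0 y1 y2 y3.
rewrite trimulE [g (vec4 x0 _ _ _)]gE [g (vec4 y0 _ _ _)]gE.
rewrite !linearDl !linearDr /= !linearZl_LR !linearZr_LR /=.
rewrite [mul e0 e1]mulC [mul _ e2]mulC [mul e1 e2]mulC ![mul _ e3]mulC.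
rewrite !e3_ e00 e10 e11 e20 e21 e22 -?gZ -?gD; congr g.
by rewrite !vec4Z !vec4D; congr (vec4 _ _ _ _); ring.
Qed.

Lemma modelled_change (N N' : 'M[K]_4) B B' :
  (forall x : 'rV_4, (x *m N) *m N' = x) ->
  (forall x y, B (x *m N) (y *m N) = B' x y *m N) ->
  modelled_by B -> modelled_by B'.
Proof.
move=> NK morphN [g [lin_g bij_g mulg]].
have NN' : N *m N' = 1%:M.
  by apply/row_matrixP => i; rewrite !rowE mulmxA NK mulmx1.
exists (fun x : 'rV_4 => g (x *m N)); split=> [k x y | | x y].
- by rewrite mulmxDl -scalemxAl lin_g.
- apply: (bij_comp bij_g).
  exists (fun y : 'rV_4 => y *m N') => x; rewrite ?NK //.
  by rewrite -mulmxA (mulmx1C NN') mulmx1.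
- by rewrite mulg morphN.
Qed.

Lemma modelled_jordan B : is_jordan mul -> modelled_by B ->
  forall x y, B (B x x) (B x y) = B x (B (B x x) y).
Proof.
move=> [_ jor] [g [_ /bij_inj g_inj mulg]] x y.
by apply: g_inj; rewrite -!mulg jor.
Qed.

Lemma modelled_isomorphic B
    (mul' : {bilinear 'rV[K]_4 -> 'rV[K]_4 -> 'rV[K]_4}) :
  B =2 mul' -> modelled_by B -> isomorphic mul mul'.
Proof.
move=> eqB [g [lin_g [h gK hK] mulg]].
pose gL := GRing.isLinear.Build K 'rV[K]_4 J *:%R g lin_g.
pose G : {linear 'rV[K]_4 -> J} := HB.pack g gL.
have lin_h : linear h := @can2_linear _ _ _ G h gK hK.
pose hL := GRing.isLinear.Build K J 'rV[K]_4 *:%R h lin_h.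
pose H : {linear J -> 'rV[K]_4} := HB.pack h hL.
exists H; split; first by exists g.
by move=> x y /=; rewrite -eqB -[RHS]gK -mulg !hK.
Qed.

End Models.

Lemma closed_sqrt (K : closedFieldType) (x : K) : exists y, y ^+ 2 = x.
Proof.
have [y yP] := @solve_monicpoly K 2 (nth 0 [:: x]) isT.
by exists y; rewrite yP !big_ord_recl big_ord0 /= expr0 mul0r mulr1 !addr0.
Qed.

Ltac vec4_simpl := rewrite !(trimulE, vec4_mulmx, vec4N, vec4Z, vec4D).

Ltac nonzero :=
  do ?[apply/andP; split];
  rewrite // ?oppr_eq0 ?mulf_neq0 ?expf_neq0 //.

(* N lists the new basis in the old one, and N' the old basis in the new one. *)
Ltac change_basis_tac N N' H tac :=
  apply: (modelled_change (N := N) (N' := N')) H;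
  [ elim/vec4P=> ? ? ? ? | elim/vec4P=> ? ? ? ?; elim/vec4P=> ? ? ? ? ];
  do ?[match goal with x := _ |- _ => subst x end];
  vec4_simpl; congr (vec4 _ _ _ _); tac; nonzero.

Ltac change_basis N N' H := change_basis_tac N N' H ltac:(field).

Ltac change_basis_modulo E N N' H := change_basis_tac N N' H ltac:(field: E).

(** * Reduction of the structure constants to the thirteen normal forms *)

Section Classification.
Variables (K : closedFieldType) (J : vectType K) (mul : {bilinear J -> J -> J}).
Hypotheses (nz2 : 2%:R != 0 :> K) (jordan_mul : is_jordan mul).

Local Notation M := (modelled_by mul).
Local Notation T := (@trimul K).
Local Notation e0 := (@vec4 K 1 0 0 0).
Local Notation e1 := (@vec4 K 0 1 0 0).
Local Notation e2 := (@vec4 K 0 0 1 0).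
Local Notation e3 := (@vec4 K 0 0 0 1).

Definition classified : Prop :=
  exists i : 'I_13, M (nth (fun _ _ => 0) (J4mul K) i).

Lemma classify i (lti : (i < 13)%N) :
  M (nth (fun _ _ => 0) (J4mul K) i) -> classified.
Proof. by exists (Ordinal lti). Qed.

Lemma classify_form11u u : M (T 0 0 1 0 0 0 1 0 0 u) -> classified.
Proof.
have [-> H | u0 H] := eqVneq u 0.
  apply: (classify (i := 2)) => //=.
  change_basis (mat4 e0 e1 e3 e2) (mat4 e0 e1 e3 e2) H.
have [k k2] := closed_sqrt u.
have k0 : k != 0 by apply: contraNneq u0 => k0; rewrite -k2 k0 expr2 mul0r.
rewrite -k2 in H; apply: (classify (i := 4)) => //=.
change_basis (mat4 e0 e1 (k^-1 *: e2) e3) (mat4 e0 e1 (k *: e2) e3) H.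
Qed.

(** The square is completed once some vector of <e1, e2> has nonzero square; if r = u = 0, the
    candidate is e1 + e2, of square 2t e3. *)
Lemma classify_form1rtu r t u : M (T 0 0 1 0 0 0 r 0 t u) -> classified.
Proof.
have main r' t' u' : r' != 0 -> M (T 0 0 1 0 0 0 r' 0 t' u') -> classified.
  move=> r0 H; have [k k2] := closed_sqrt r'.
  have k0 : k != 0 by apply: contraNneq r0 => k0; rewrite -k2 k0 expr2 mul0r.
  rewrite -k2 in H.
  apply: (@classify_form11u (u' - t' ^+ 2 / k ^+ 2)).
  change_basis (mat4 e0 (k^-1 *: e1) (e2 - (t' / k ^+ 2) *: e1) e3)
    (mat4 e0 (k *: e1) (e2 + (t' / k) *: e1) e3) H.
have [-> | r0 H] := eqVneq r 0; last exact: main H.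
have [-> | u0 H] := eqVneq u 0; last first.
  apply: (main u t 0) => //.
  change_basis (mat4 e0 e2 e1 e3) (mat4 e0 e2 e1 e3) H.
have [-> H | t0 H] := eqVneq t 0; last first.
  apply: (main (2%:R * t) t 0); first by rewrite mulf_neq0.
  change_basis (mat4 e0 (e1 + e2) e2 e3) (mat4 e0 (e1 - e2) e2 e3) H.
apply: (classify (i := 1)) => //=.
change_basis (mat4 e0 e3 e1 e2) (mat4 e0 e2 e3 e1) H.
Qed.

(** The constants are those of a ternary quadratic form with values in <e3>. As 2 is invertible, a
    nonzero form has a vector with nonzero value; its orthogonal complement is split off. *)
Lemma classify_form p q r s t u : M (T 0 0 p 0 q 0 r s t u) -> classified.
Proof.
have main p' q' r' s' t' u' :
    p' != 0 -> M (T 0 0 p' 0 q' 0 r' s' t' u') -> classified.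
  move=> p0 H.
  apply: (@classify_form1rtu ((r' - q' ^+ 2 / p') / p')
    ((t' - q' * s' / p') / p') ((u' - s' ^+ 2 / p') / p')).
  change_basis
    (mat4 e0 (e1 - (q' / p') *: e0) (e2 - (s' / p') *: e0) (p' *: e3))
    (mat4 e0 (e1 + (q' / p') *: e0) (e2 + (s' / p') *: e0) (p'^-1 *: e3)) H.
have [-> | p0 H] := eqVneq p 0; last exact: main H.
have [-> | r0 H] := eqVneq r 0; last first.
  apply: (main r q 0 t s u) => //.
  change_basis (mat4 e1 e0 e2 e3) (mat4 e1 e0 e2 e3) H.
have [-> | u0 H] := eqVneq u 0; last first.
  apply: (main u t 0 s q 0) => //.
  change_basis (mat4 e2 e1 e0 e3) (mat4 e2 e1 e0 e3) H.
have [-> | q0 H] := eqVneq q 0; last first.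
  apply: (main (2%:R * q) q 0 (s + t) t 0); first by rewrite mulf_neq0.
  change_basis (mat4 (e0 + e1) e1 e2 e3) (mat4 (e0 - e1) e1 e2 e3) H.
have [-> | s0 H] := eqVneq s 0; last first.
  apply: (main (2%:R * s) t 0 s t 0); first by rewrite mulf_neq0.
  change_basis (mat4 (e0 + e2) e1 e2 e3) (mat4 (e0 - e2) e1 e2 e3) H.
have [-> H | t0 H] := eqVneq t 0; last first.
  apply: (main (2%:R * t) 0 0 t 0 0); first by rewrite mulf_neq0.
  change_basis (mat4 (e1 + e2) e0 e2 e3) (mat4 e1 (e0 - e2) e2 e3) H.
exact: (classify (i := 0)) H.
Qed.

(** Modulo e3 only e0^2 = e1 survives. Testing t, q, u and s in turn leads to J_{4,6}; J_{4,4} or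
    J_{4,7}; J_{4,13}; J_{4,12} or J_{4,2}. *)
Lemma classify_rank1 q s t u : M (T 1 0 0 0 q 0 0 s t u) -> classified.
Proof.
have [-> | t0 H] := eqVneq t 0; last first.
  (* For a = e0 + f e1 - (q/t) e2 and c = e2 + m e1: [m] gives c^2 = 0, the coefficient -q/t gives a
     o e1 = 0, [f] gives a o c = 0, and [b] is the e3-coordinate of a^2. *)
  pose m := - (u / (2%:R * t)); pose f := (q * u / t - s) / t.
  pose b := (q / t) ^+ 2 * u - 2%:R * (q / t) * s.
  apply: (classify (i := 5)) => //=.
  pose b' := e1 - (b / t) *: e3; pose c' := e2 - m *: b'.
  change_basis (mat4 (e0 + f *: e1 - (q / t) *: e2) (e1 + b *: e3)
                 (e2 + m *: e1) (t *: e3))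
    (mat4 (e0 - f *: b' + (q / t) *: c') b' c' (t^-1 *: e3)) H.
have [-> | q0 H] := eqVneq q 0; last first.
  (* [c'] has product 0 with e0. If u is nonzero, scaling it by [k] makes its square equal to e0 o
     e1. *)
  pose c' := e2 - (s / q) *: e1.
  have [u0 | u0] := eqVneq u 0.
    rewrite u0 in H; apply: (classify (i := 3)) => //=.
    change_basis (mat4 e0 e1 (q *: e3) c')
      (mat4 e0 e1 (e3 + (s / q) *: e1) (q^-1 *: e2)) H.
  have [k k2] := closed_sqrt (q / u).
  have k0 : k != 0.
    apply: contraNneq q0 => k0; rewrite -[q](mulfVK u0) -k2 k0.
    by apply/eqP; ring.
  have {k2}qE : q = k ^+ 2 * u by rewrite k2 mulfVK.
  rewrite qE in c' H; apply: (classify (i := 6)) => //=.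
  change_basis (mat4 e0 e1 (k *: c') ((k ^+ 2 * u) *: e3))
    (mat4 e0 e1 (k^-1 *: e2 + (s / (k ^+ 2 * u)) *: e1)
       ((k ^+ 2 * u)^-1 *: e3)) H.
have [-> | u0 H] := eqVneq u 0; last first.
  apply: (classify (i := 12)) => //=.
  (* The vector v = e0 - (s/u) e2 has product 0 with e2. With a = v + e2 and b = v - e2, a^2 = b^2 =
     v^2 + e2^2 and a o b = v^2 - e2^2. *)
  change_basis
    (mat4 (e0 + (1 - s / u) *: e2) (e0 - (1 + s / u) *: e2)
       (e1 + (u - s ^+ 2 / u) *: e3) (e1 - (u + s ^+ 2 / u) *: e3))
    (mat4 (2%:R^-1 *: ((1 + s / u) *: e0 + (1 - s / u) *: e1))
       (2%:R^-1 *: ((1 + s ^+ 2 / u ^+ 2) *: e2 + (1 - s ^+ 2 / u ^+ 2) *: e3))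
       (2%:R^-1 *: (e0 - e1)) ((2%:R * u)^-1 *: (e2 - e3))) H.
have [-> H | s0 H] := eqVneq s 0; last first.
  apply: (classify (i := 11)) => //=.
  change_basis (mat4 e0 e2 e1 (s *: e3)) (mat4 e0 e2 e1 (s^-1 *: e3)) H.
exact: (classify (i := 1)) H.
Qed.

(** The Jordan identity at (e0, e0) equates e0^2 o e0^2 with e0 o (e0 o e0^2), giving r2 = 0 and r3
    = q2 s. If q2 is nonzero, two more instances kill t and u, and e0, e0^2, e0^3, e3 is a basis;
    what remains is whether the fourth power of e0 vanishes. *)
Lemma classify_generated q2 q3 r2 r3 s t u :
  M (T 1 0 0 q2 q3 r2 r3 s t u) -> classified.
Proof.
move=> H; have jor := modelled_jordan jordan_mul H.
have := jor e0 e0; vec4_simpl => /vec4_inj[_ _ E2 E3].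
have r20 : r2 = 0 by apply: etrans (etrans _ E2) _; ring.
have r3E : r3 = q2 * s by apply: etrans (etrans _ E3) _; ring.
rewrite {}r20 {}r3E {E2 E3} in H jor.
have [q20 | q20] := eqVneq q2 0.
  by rewrite q20 mul0r in H; exact: classify_rank1 H.
have := jor e0 e1; vec4_simpl => /vec4_inj[_ _ _ E3].
have t0 : t = 0.
  by apply: (mulfI q20); apply: etrans (etrans _ E3) _; ring.
have := jor (e0 + e2) e0; vec4_simpl => /vec4_inj[_ _ _ {}E3].
have u0 : u = 0.
  apply: (mulfI q20); apply: (addrI (q2 * s)).
  by apply/esym; apply: etrans (etrans _ E3) _; ring.
rewrite {}t0 {}u0 {E3 jor} in H.
have {}H : M (T 1 0 0 1 0 0 (q2 * s) (q2 * s) 0 0).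
  change_basis (mat4 e0 e1 (q2 *: e2 + q3 *: e3) e3)
    (mat4 e0 e1 (q2^-1 *: (e2 - q3 *: e3)) e3) H.
have [s0 | s0] := eqVneq (q2 * s) 0.
  by rewrite s0 in H; exact: (classify (i := 3)) H.
move: (q2 * s) s0 H => {}s s0 H; apply: (classify (i := 10)) => //=.
change_basis (mat4 e0 e1 e2 (s *: e3)) (mat4 e0 e1 e2 (s^-1 *: e3)) H.
Qed.

(** Since e2 and e3 are central, the product is a pair of quadratic forms on <e0, e1>. Diagonalizing
    both at once gives J_{4,3} or J_{4,13}; when this fails, a vector of square 0 gives J_{4,12}. *)
Lemma classify_rank2_cube0 q r : M (T 0 1 0 0 q 1 r 0 0 0) -> classified.
Proof.
have [-> H | q0 H] := eqVneq q 0.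
  have [r0 | r0] := eqVneq r 0.
    by rewrite r0 in H; exact: (classify (i := 2)) H.
  apply: (classify (i := 12)) => //=.
  change_basis (mat4 (e0 + e1) (e0 - e1) (2%:R *: e2 + r *: e3) (- r *: e3))
    (mat4 (2%:R^-1 *: (e0 + e1)) (2%:R^-1 *: (e0 - e1)) (2%:R^-1 *: (e2 + e3))
       (- r^-1 *: e3)) H.
(* For such x, the elements e0 - x e1 and x e0 + e1 have product 0. *)
have [x xE] : exists x, q * x ^+ 2 + r * x - q = 0.
  have [k k2] := closed_sqrt ((r / q) ^+ 2 + 4%:R).
  have nz4 : 4%:R != 0 :> K by rewrite (natrM _ 2 2) mulf_neq0.
  exists ((k - r / q) / 2%:R).
  rewrite (_ : _ - q = q / 4%:R * (k ^+ 2 - ((r / q) ^+ 2 + 4%:R))).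
    by rewrite k2 subrr mulr0.
  by field; rewrite ?nz2 ?nz4 ?q0.
have x0 : x != 0.
  apply: contraNneq q0 => x0; rewrite x0 in xE; apply/eqP.
  by apply: oppr_inj; rewrite oppr0 -xE; ring.
have {xE}rE : r = q * (1 - x ^+ 2) / x.
  apply: (mulIf x0); rewrite mulfVK //; apply: (addrI (q * x ^+ 2 - q)).
  by rewrite addrAC xE; ring.
rewrite {}rE {r} in H.
(* If x^2 = -1, the two vectors are proportional and e0 - x e1 has square 0. *)
have [x2 | x2] := eqVneq (1 + x ^+ 2) 0.
  have {}x2 : x ^+ 2 = -1 by apply/eqP; rewrite -addr_eq0 addrC x2.
  apply: (classify (i := 11)) => //=.
  change_basis_modulo x2 (mat4 e0 (e0 - x *: e1) e2 (e2 - (x * q) *: e3))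
    (mat4 e0 (x^-1 *: (e0 - e1)) e2 ((x * q)^-1 *: (e2 - e3))) H.
(* With a and b the sum and difference of the two vectors, a^2 = b^2 is the sum of their squares, 2w
   e2 + v' e3, and a o b is the difference, v e3. *)
pose w := 1 + x ^+ 2; pose v := - (q / x * w ^+ 2).
pose v' := q * (1 - x ^+ 2) / x * w.
apply: (classify (i := 12)) => //=.
change_basis
  (mat4 ((1 + x) *: e0 + (1 - x) *: e1) ((1 - x) *: e0 - (1 + x) *: e1)
    (2%:R * w *: e2 + v' *: e3) (v *: e3))
  (mat4 ((2%:R * w)^-1 *: ((1 + x) *: e0 + (1 - x) *: e1))
    ((2%:R * w)^-1 *: ((1 - x) *: e0 - (1 + x) *: e1))
    ((2%:R * w)^-1 *: (e2 - (v' / v) *: e3)) (v^-1 *: e3)) H.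
Qed.

(** The value s^2 + t^2 of the dual form at l tells an anisotropic l, giving J_{4,8}, from an
    isotropic one, giving J_{4,9} or J_{4,10}, or from l = 0. *)
Lemma classify_rank2 q r s t : M (T 0 1 0 0 q 1 r s t 0) -> classified.
Proof.
have [n0 | n0 H] := eqVneq (s ^+ 2 + t ^+ 2) 0; last first.
  (* The vectors s e0 + t e1 and s e1 - t e0 have l-values n and 0, squares n e2 + A2 e3 and n e2 +
     B2 e3, and product AB e3. Adding f e2 and g e2 to them makes the squares equal and the product
     0. *)
  pose n := s ^+ 2 + t ^+ 2.
  pose A2 := 2%:R * s * t * q + t ^+ 2 * r.
  pose B2 := s ^+ 2 * r - 2%:R * s * t * q.
  pose AB := (s ^+ 2 - t ^+ 2) * q + s * t * r.
  pose f := (B2 - A2) / (2%:R * n); pose g := - (AB / n).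
  pose d' := (n ^+ 2)^-1 *: e3; pose c' := n^-1 *: (e2 - B2 *: d').
  pose a' := e0 - f *: c'; pose b' := e1 - g *: c'.
  apply: (classify (i := 7)) => //=.
  change_basis
    (mat4 (s *: e0 + t *: e1 + f *: e2) (s *: e1 - t *: e0 + g *: e2)
       (n *: e2 + B2 *: e3) (n ^+ 2 *: e3))
    (mat4 (n^-1 *: (s *: a' - t *: b')) (n^-1 *: (t *: a' + s *: b')) c' d') H.
have [s0 | s0 H] := eqVneq s 0.
  move: n0; rewrite s0 expr0n add0r => /eqP; rewrite expf_eq0 => /eqP ->.
  exact: classify_rank2_cube0.
pose x := t / s.
have x2 : x ^+ 2 = -1.
  apply/eqP; rewrite /x expr_div_n -addr_eq0 -(mulfV (expf_neq0 2 s0)).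
  by rewrite -mulrDl addrC n0 mul0r.
have tE : t = x * s by rewrite /x mulfVK.
have x0 : x != 0.
  by apply: contra_eq_neq x2 => ->; rewrite expr0n eq_sym oppr_eq0 oner_eq0.
move: x x2 x0 tE {n0} => x x2 x0 tE; rewrite {}tE {t} in H.
(* Scaling e1 by -x turns x0^2 + x1^2 into x0^2 - x1^2 and makes both l-values s; the multiple of e2
   added to e0 makes the two squares exactly opposite. *)
have {}H : M (T 0 1 0 0 (r / 2%:R - x * q) (-1) 0 s s 0).
  change_basis_modulo x2
    (mat4 (e0 + (r / (2%:R * s)) *: e2) (- x *: e1) (e2 + r *: e3) e3)
    (mat4 (e0 - (r / (2%:R * s)) *: (e2 - r *: e3)) (x *: e1) (e2 - r *: e3) e3)
    H.
have [w0 | w0] := eqVneq (r / 2%:R - x * q) 0.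
  rewrite w0 in H; apply: (classify (i := 8)) => //=.
  change_basis (mat4 e0 e1 e2 (s *: e3)) (mat4 e0 e1 e2 (s^-1 *: e3)) H.
move: (r / 2%:R - x * q) w0 H => w w0 H.
(* This scale makes the coefficient k^2 w of a o b equal to the coefficient k^3 s of a o c. *)
pose k := w / s; apply: (classify (i := 9)) => //=.
change_basis (mat4 (k *: e0) (k *: e1) (k ^+ 2 *: e2) (k ^+ 3 * s *: e3))
  (mat4 (k^-1 *: e0) (k^-1 *: e1) ((k ^+ 2)^-1 *: e2)
     ((k ^+ 3 * s)^-1 *: e3)) H.
Qed.

Lemma classify_square p2 p3 q2 q3 r2 r3 s t u :
  p2 != 0 -> M (T 0 p2 p3 q2 q3 r2 r3 s t u) -> classified.
Proof.
move=> p0 H.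
have {p2 p3 q2 q3 r2 r3 s t u p0 H} [q [r2 [r3 [s [t [u H]]]]]] :
    exists q r2 r3 s t u, M (T 0 1 0 0 q r2 r3 s t u).
  (* Subtracting x e0 from e1 puts its product with e0 into <e3>; e2 is replaced by e0^2. *)
  pose x := q2 / p2; pose r2' := (r2 - q2 * x) / p2.
  pose r3' := r3 - 2%:R * x * q3 + x ^+ 2 * p3 - r2' * p3.
  exists (q3 - x * p3), r2', r3', (p2 * s), (p2 * (t - x * s)), (p2 ^+ 2 * u).
  change_basis (mat4 e0 (e1 - x *: e0) (p2 *: e2 + p3 *: e3) e3)
    (mat4 e0 (e1 + x *: e0) (p2^-1 *: (e2 - p3 *: e3)) e3) H.
have /(_ e0 e0) := modelled_jordan jordan_mul H.
vec4_simpl => /vec4_inj[_ _ _ E3].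
have u0 : u = 0 by apply: etrans (etrans _ E3) _; ring.
rewrite {}u0 {E3} in H; have [r20 | r20] := eqVneq r2 0.
  rewrite r20 in H; apply: (@classify_rank1 s q t r3).
  change_basis (mat4 e0 e2 e1 e3) (mat4 e0 e2 e1 e3) H.
have [k k2] := closed_sqrt r2.
have k0 : k != 0 by apply: contraNneq r20 => k0; rewrite -k2 k0 expr2 mul0r.
rewrite -k2 in H; apply: (@classify_rank2 (q / k) (r3 / k ^+ 2) s (t / k)).
change_basis (mat4 e0 (k^-1 *: e1) e2 e3) (mat4 e0 (k *: e1) e2 e3) H.
Qed.

Lemma nilpotent_classified :
  is_nilpotent mul -> \dim {: J} = 4%N -> classified.
Proof.
move=> nilJ dimJ.
have [p1 [p2 [p3 [q2 [q3 [r2 [r3 [s [t [u H]]]]]]]]]] :=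
  nilpotent_trimul jordan_mul.1 nilJ dimJ.
have [p10 | p10] := eqVneq p1 0; last first.
  apply: (@classify_generated (p1 * q2) (p1 * q3 + p2 * s) (p1 ^+ 2 * r2)
    (p1 ^+ 2 * r3 + 2%:R * p1 * p2 * t + p2 ^+ 2 * u) s (p1 * t + p2 * u) u).
  change_basis (mat4 e0 (p1 *: e1 + p2 *: e2 + p3 *: e3) e2 e3)
    (mat4 e0 (p1^-1 *: (e1 - p2 *: e2 - p3 *: e3)) e2 e3) H.
rewrite {}p10 in H; have [p20 | p20] := eqVneq p2 0; last first.
  exact: classify_square H.
rewrite {}p20 in H; have [r20 | r20] := eqVneq r2 0; last first.
  apply: (@classify_square r2 r3 q2 q3 0 p3 t s u) => //.
  change_basis (mat4 e1 e0 e2 e3) (mat4 e1 e0 e2 e3) H.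
rewrite {}r20 in H; have [q20 | q20] := eqVneq q2 0; last first.
  (* With p2 = r2 = 0, the square of e0 + e1 is 2 q2 e2 modulo e3. *)
  apply: (@classify_square (2%:R * q2) (p3 + 2%:R * q3 + r3) q2 (q3 + r3) 0 r3
    (s + t) t u); first by rewrite mulf_neq0.
  change_basis (mat4 (e0 + e1) e1 e2 e3) (mat4 (e0 - e1) e1 e2 e3) H.
by rewrite q20 in H; exact: classify_form H.
Qed.

End Classification.

(** * First-order invariants and their table of values *)

Section Invariants.
Variable K : fieldType.

(** Clause 5 says that J^2 has dimension at most 1. For commutative products, [x] ranges over the
    second centre in clause 6 and over the annihilator of J^2 in the last two. *)
Definition invariant (k : nat) (J : lmodType K) (mul : J -> J -> J) : Prop :=
  match k with
  | 0 => forall x, (forall y, mul x y = 0) -> exists u v, x = mul u v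
  | 1 => forall x y, mul x y = 0
  | 2 => forall x y z, mul (mul x y) z = 0
  | 3 => forall x y z w, mul (mul (mul x y) z) w = 0
  | 4 => forall x, mul x x = 0 -> forall y, mul x y = 0
  | 5 => exists d, forall x y, exists k, mul x y = k *: d
  | 6 => forall x, (forall y z, mul (mul x y) z = 0) -> mul x x = 0
  | 7 => forall x, (forall y z, mul (mul y z) x = 0) ->
           forall y, mul (mul x x) y = 0
  | _ => forall x, (forall y z, mul (mul y z) x = 0) -> mul x x = 0
  end.

Lemma invariant_morph k (J1 J2 : lmodType K) (mul1 : J1 -> J1 -> J1)
    (mul2 : J2 -> J2 -> J2) (f : {linear J1 -> J2}) :
  bijective f -> {morph f : x y / mul1 x y >-> mul2 x y} ->
  invariant k mul1 -> invariant k mul2.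
Proof.
move=> [g fK gK] mulf.
have f_eq0 x : f x = 0 -> x = 0 by rewrite -(raddf0 f) => /(can_inj fK).
have all_f (P : J2 -> Prop) : (forall x, P (f x)) -> forall x, P x.
  by move=> Pf x; rewrite -(gK x).
case: k => [|[|[|[|[|[|[|[|k]]]]]]]] /=.
- move=> inv; apply: (all_f) => x x0; have [|u [v ->]] := inv x.
    by move=> y; apply: f_eq0; rewrite mulf.
  by exists (f u), (f v); rewrite mulf.
- by move=> inv; do 2!apply: (all_f) => ?; rewrite -mulf inv raddf0.
- by move=> inv; do 3!apply: (all_f) => ?; rewrite -!mulf inv raddf0.
- by move=> inv; do 4!apply: (all_f) => ?; rewrite -!mulf inv raddf0.
- move=> inv; apply: (all_f) => x; rewrite -mulf => /f_eq0/inv x0.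
  by apply: (all_f) => y; rewrite -mulf x0 raddf0.
- move=> [d inv]; exists (f d); apply: (all_f) => x; apply: (all_f) => y.
  by rewrite -mulf; have [c ->] := inv x y; exists c; rewrite linearZ.
- move=> inv; apply: (all_f) => x x0; rewrite -mulf inv ?raddf0 // => y z.
  by apply: f_eq0; rewrite !mulf.
- move=> inv; apply: (all_f) => x x0; apply: (all_f) => y.
  rewrite -!mulf inv ?raddf0 // => u v.
  by apply: f_eq0; rewrite !mulf.
- move=> inv; apply: (all_f) => x x0; rewrite -mulf inv ?raddf0 // => y z.
  by apply: f_eq0; rewrite !mulf.
Qed.

Lemma isomorphic_sym (J1 J2 : vectType K) (mul1 : {bilinear J1 -> J1 -> J1})
    (mul2 : {bilinear J2 -> J2 -> J2}) :
  isomorphic mul1 mul2 -> isomorphic mul2 mul1.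
Proof.
move=> [f [[g fK gK] mulf]].
pose gL := GRing.isLinear.Build K J2 J1 *:%R g (can2_linear fK gK).
pose G : {linear J2 -> J1} := HB.pack g gL.
exists G; split; first by exists f.
by move=> x y /=; apply: (can_inj fK); rewrite mulf !gK.
Qed.

Lemma isomorphic_invariant k (J1 J2 : vectType K)
    (mul1 : {bilinear J1 -> J1 -> J1}) (mul2 : {bilinear J2 -> J2 -> J2}) :
  isomorphic mul1 mul2 -> invariant k mul1 <-> invariant k mul2.
Proof.
move=> iso12; split.
  by case: iso12 => f [bij_f mulf]; exact: invariant_morph bij_f mulf.
case: (isomorphic_sym iso12) => f [bij_f mulf].
exact: invariant_morph bij_f mulf.
Qed.

Lemma J4_invariant k (i : 'I_13) :
  invariant k (J4 K i) <-> invariant k (nth (fun _ _ => 0) (J4mul K) i).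
Proof.
pose id4 : {linear 'rV[K]_4 -> 'rV[K]_4} := idfun.
have id_bij : bijective id4 by exists id4.
by split; apply: (invariant_morph id_bij) => x y; rewrite /= J4E.
Qed.

(* None marks a value that is not needed to separate the algebras. *)
Definition invariant_table : seq (seq (option bool)) :=
  let T := Some true in let F := Some false in let N := None in
  [:: [:: F; F; F; F; T; T; T; T; T; T; T; T; T];
      [:: T; F; F; F; N; N; N; N; N; N; N; N; N];
      [:: N; T; T; F; T; F; F; F; F; F; F; T; T];
      [:: N; N; N; N; N; T; T; T; T; T; F; N; N];
      [:: N; T; F; N; N; N; N; N; N; N; N; F; T];
      [:: N; N; N; N; T; N; N; N; N; N; N; F; F];
      [:: N; N; N; N; N; F; F; T; T; T; N; N; N];
      [:: N; N; N; N; N; F; T; F; T; T; N; N; N];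
      [:: N; N; N; N; N; N; N; N; T; F; N; N; N]].

Definition invariant_at k i : option bool :=
  nth None (nth [::] invariant_table k) i.

Lemma invariant_table_separates i j : (i < 13)%N -> (j < 13)%N ->
  (forall k b, invariant_at k i = Some b -> invariant_at k j != Some (~~ b)) ->
  i = j.
Proof.
pose differ k := if invariant_at k i is Some b
                 then invariant_at k j == Some (~~ b) else false.
move=> lti ltj sep; suff: (i == j) || has differ (iota 0 9).
  case/orP=> [/eqP // | /hasP[k _]]; rewrite /differ.
  by case E: (invariant_at k i) => [b|//]; rewrite (negPf (sep _ _ E)).
(* All 169 pairs of indices are checked by evaluation. *)
have /allP/(_ i)/[!mem_iota]/(_ lti)/allP/(_ j)/[!mem_iota]/(_ ltj) // :
  all (fun i => all (fun j => (i == j) || has (fun k =>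
    if invariant_at k i is Some b then invariant_at k j == Some (~~ b)
    else false)
    (iota 0 9)) (iota 0 13)) (iota 0 13) by [].
Qed.

End Invariants.

(** * Central components and products *)

Section Central.
Variables (K : fieldType) (J : vectType K) (mul : {bilinear J -> J -> J}).

(** If a nonzero x in I2 were u o v, the I2-part of u would contribute nothing, so x would also lie
    in I1. *)
Lemma central_component_notin_square :
  has_central_component mul -> ~ invariant 0 mul.
Proof.
move=> [I1 [I2 [[idl1 _] [defJ dirJ] I2n0 cI2]]] sq.
have xI2 := memv_pick I2; set x := vpick I2 in xI2.
have [u [v xuv]] := sq x (cI2 x xI2).
have /memv_addP[u1 u1I1 [u2 u2I2 def_u]] : u \in (I1 + I2)%VS.
  by rewrite defJ memvf.
have xI1 : x \in I1.
  by rewrite xuv def_u linearDl /= (cI2 u2) // addr0; case: (idl1 u1 v u1I1).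
case: I2n0; apply/eqP; rewrite -vpick0; apply/eqP.
have: x \in (I1 :&: I2)%VS by rewrite memv_cap xI1.
by move/directv_addP: dirJ => ->; rewrite memv0 => /eqP.
Qed.

(** The kernel of [phi] contains all products, hence is an ideal; the line of [x] complements it. *)
Lemma functional_central_component (phi : {linear J -> K^o}) (x : J) :
  (forall u v, phi (mul u v) = 0) -> in_centre mul x -> commutative mul ->
  phi x != 0 -> has_central_component mul.
Proof.
move=> phi_mul cx mulC phix.
pose I1 := lker (linfun phi).
have I1P v : (v \in I1) = (phi v == 0) by rewrite memv_ker lfunE.
exists I1, <[x]>%VS; split.
- split=> [u v _ | u v /vlineP[k ->]]; first by rewrite !I1P !phi_mul eqxx.
  by rewrite [mul v _]mulC linearZl_LR /= cx scaler0 mem0v.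
- split; last first.
    apply/directv_addP/eqP; rewrite -subv0; apply/subvP => v.
    rewrite memv_cap I1P => /andP[+ /vlineP[k def_v]].
    rewrite def_v linearZ /= mulf_eq0 (negPf phix) orbF => /eqP->.
    by rewrite scale0r mem0v.
  apply/eqP; rewrite eqEsubv subvf; apply/subvP => v _.
  rewrite -(subrK ((phi v / phi x) *: x) v) memv_add ?memvZ ?memv_line //.
  by rewrite I1P linearB linearZ /= [_ *: _]mulfVK ?subrr.
- move/eqP; rewrite -dimv_eq0 dim_vline; have [x0 | //] := eqVneq x 0.
  by rewrite x0 linear0 eqxx in phix.
- by move=> _ /vlineP[k ->] y; rewrite linearZl_LR /= cx scaler0.
Qed.

End Central.

Ltac case13 i := case: i => [[|[|[|[|[|[|[|[|[|[|[|[|[|i]]]]]]]]]]]]] // lti].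

(** * Nilpotency, Jordan identity and central components of the thirteen models *)

Section Tables.
Variable K : fieldType.

Local Notation e0 := (@vec4 K 1 0 0 0).
Local Notation e1 := (@vec4 K 0 1 0 0).
Local Notation e2 := (@vec4 K 0 0 1 0).
Local Notation e3 := (@vec4 K 0 0 0 1).

(** Multiplication by [J] descends the flag <e1, e2, e3>, <e2, e3>, <e3>, 0. *)
Lemma trimul_nilpotent (mul : {bilinear 'rV[K]_4 -> 'rV[K]_4 -> 'rV[K]_4})
    p1 p2 p3 q2 q3 r2 r3 s t u :
  mul =2 trimul p1 p2 p3 q2 q3 r2 r3 s t u -> is_nilpotent mul.
Proof.
move=> mulE.
have in3 v : v \in <<[:: e3]>>%VS -> exists d, v = vec4 0 0 0 d.
  rewrite span_seq1 => /vlineP[d ->]; exists d.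
  by rewrite vec4Z !mulr0 mulr1.
have in2 v : v \in <<[:: e2; e3]>>%VS -> exists c d, v = vec4 0 0 c d.
  rewrite span_cons => /memv_addP[_ /vlineP[c ->] [w /in3[d ->] ->]].
  by exists c, d; rewrite vec4Z vec4D !mulr0 mulr1 !(add0r, addr0).
have in1 v : v \in <<[:: e1; e2; e3]>>%VS -> exists b c d, v = vec4 0 b c d.
  rewrite span_cons => /memv_addP[_ /vlineP[b ->] [w /in2[c [d ->]] ->]].
  by exists b, c, d; rewrite vec4Z vec4D !mulr0 mulr1 !(add0r, addr0).
have span3 d (X : seq _) : e3 \in X -> vec4 0 0 0 d \in <<X>>%VS.
  move=> Xe3; rewrite (_ : vec4 _ _ _ _ = d *: e3) ?memvZ ?memv_span //.
  by rewrite vec4Z !mulr0 mulr1.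
have span2 c d (X : seq _) : e2 \in X -> e3 \in X -> vec4 0 0 c d \in <<X>>%VS.
  move=> Xe2 Xe3; rewrite (_ : vec4 _ _ _ _ = c *: e2 + vec4 0 0 0 d).
    by rewrite memvD ?span3 // memvZ ?memv_span.
  by rewrite vec4Z vec4D !mulr0 mulr1 !(add0r, addr0).
have span1 b c d (X : seq _) : e1 \in X -> e2 \in X -> e3 \in X ->
    vec4 0 b c d \in <<X>>%VS.
  move=> Xe1 Xe2 Xe3; rewrite (_ : vec4 _ _ _ _ = b *: e1 + vec4 0 0 c d).
    by rewrite memvD ?span2 // memvZ ?memv_span.
  by rewrite vec4Z vec4D !mulr0 mulr1 !(add0r, addr0).
exists 5; apply/eqP; rewrite -subv0 -span_nil.
have cpow2 : (cpow mul 2 <= <<[:: e1; e2; e3]>>)%VS.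
  apply/prodsp_min; elim/vec4P=> x0 x1 x2 x3; elim/vec4P=> y0 y1 y2 y3 _ _.
  by rewrite mulE trimulE span1 // !inE eqxx ?orbT.
have cpow3 : (cpow mul 3 <= <<[:: e2; e3]>>)%VS.
  apply/prodsp_min => x + /(subvP cpow2)/in1[x1 [x2 [x3 ->]]] _.
  elim/vec4P=> y0 y1 y2 y3.
  by rewrite mulE trimulE !mul0r mulr0 span2 // !inE eqxx ?orbT.
have cpow4 : (cpow mul 4 <= <<[:: e3]>>)%VS.
  apply/prodsp_min => x + /(subvP cpow3)/in2[x2 [x3 ->]] _.
  elim/vec4P=> y0 y1 y2 y3.
  by rewrite mulE trimulE !(mul0r, mulr0, addr0) span3 // !inE eqxx ?orbT.
apply/prodsp_min => x + /(subvP cpow4)/in3[x3 ->] _.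
elim/vec4P=> y0 y1 y2 y3.
by rewrite mulE trimulE !(mul0r, mulr0, addr0) -vec4_0 mem0v.
Qed.

Lemma J4_nilpotent (i : 'I_13) : is_nilpotent (J4 K i).
Proof.
suff [p1 [p2 [p3 [q2 [q3 [r2 [r3 [s [t [u H]]]]]]]]]] :
    exists p1 p2 p3 q2 q3 r2 r3 s t u, nth (fun _ _ => 0) (J4mul K) i =
      trimul p1 p2 p3 q2 q3 r2 r3 s t u.
  by apply: trimul_nilpotent => x y; rewrite J4E H.
by case13 i; do 10!eexists; reflexivity.
Qed.

Lemma J4_jordan (i : 'I_13) : is_jordan (J4 K i).
Proof.
split; elim/vec4P=> x0 x1 x2 x3; elim/vec4P=> y0 y1 y2 y3; rewrite !J4E;
  by case13 i; rewrite /= !trimulE; congr (vec4 _ _ _ _); ring.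
Qed.

(** In the first four tables d occurs in no product, neither as a factor nor as a value. *)
Lemma J4_central_component (i : 'I_13) :
  (i < 4)%N -> has_central_component (J4 K i).
Proof.
move=> lti4.
pose coord3 (x : 'rV[K]_4) : K^o := x 0 (inord 3).
have lin_coord3 : linear coord3 by move=> k x y; rewrite /coord3 !mxE.
pose phiL := GRing.isLinear.Build K 'rV[K]_4 K^o *:%R coord3 lin_coord3.
pose phi : {linear 'rV[K]_4 -> K^o} := HB.pack coord3 phiL.
have phiE x0 x1 x2 x3 : phi (vec4 x0 x1 x2 x3) = x3.
  by rewrite /= /coord3 mxE inordK.
apply: (@functional_central_component _ _ _ phi e3); last 1 first.
- by rewrite phiE oner_eq0.
- elim/vec4P=> x0 x1 x2 x3; elim/vec4P=> y0 y1 y2 y3; rewrite J4E.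
  by move: lti4; case13 i => _;
    rewrite [nth _ _ _]/= trimulE phiE !mul0r !addr0.
- elim/vec4P=> y0 y1 y2 y3; rewrite J4E [RHS]vec4_0.
  by move: lti4; case13 i => _; rewrite /= trimulE !(mul0r, mulr0, addr0).
- by case: (J4_jordan i).
Qed.


End Tables.

(* Derives a goal that is, up to ring normalization and a global sign, the
   equation E. *)
Ltac from E :=
  solve [apply: etrans (etrans _ E) _; ring
       | apply: oppr_inj; apply: etrans (etrans _ E) _; ring].

Ltac coords_in H := move: (H); rewrite /= !trimulE vec4_0 => /vec4_inj[].

Ltac vec4_ring :=
  rewrite /= ?(vec4N, vec4Z, vec4D) ?trimulE ?vec4_0;
  congr (vec4 _ _ _ _); ring.

Ltac all_zero := do ?[elim/vec4P=> ? ? ? ?]; vec4_ring.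

(** * Computation of the invariants *)

Section InvariantValues.
Variable K : closedFieldType.
Hypothesis nz2 : 2%:R != 0 :> K.

Local Notation e0 := (@vec4 K 1 0 0 0).
Local Notation e1 := (@vec4 K 0 1 0 0).
Local Notation e2 := (@vec4 K 0 0 1 0).
Local Notation e3 := (@vec4 K 0 0 0 1).

Ltac nonzero_product H :=
  let E1 := fresh "E" in let E2 := fresh "E" in let E3 := fresh "E" in
  coords_in H; intros _ E1 E2 E3; move/eqP: (oner_neq0 K); apply;
  first [from E1 | from E2 | from E3].

Lemma J4_invariant_at k (i : 'I_13) b : invariant_at k i = Some b ->
  if b then invariant k (J4 K i) else ~ invariant k (J4 K i).
Proof.
suff: invariant_at k i = Some b ->
    if b then invariant k (nth (fun _ _ => 0) (J4mul K) i)
    else ~ invariant k (nth (fun _ _ => 0) (J4mul K) i).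
  have [J4inv invJ4] := J4_invariant K k i.
  by move=> inv /inv; case: b {inv} => [/invJ4 | ninv /J4inv].
case: k => [|[|[|[|[|[|[|[|[|k]]]]]]]]]; last 1 first.
  by rewrite /invariant_at /= !nth_nil.
all: case13 i; rewrite /invariant_at //= => -[<-].
(* Here e3 is central, but every product has last coordinate 0. *)
1-4: move/(_ e3)=> [|u [v]]; first (by all_zero);
  elim/vec4P: u => ? ? ? ?; elim/vec4P: v => ? ? ? ?;
  rewrite trimulE => /vec4_inj[_ _ _ E]; move/eqP: (oner_neq0 K); apply; from E.
(* Multiplying a central element by e0, e1, e2 shows that it lies in <d>, or in <c, d> for J_{4,12}
   and J_{4,13}. *)
1-9: elim/vec4P=> x0 x1 x2 x3 cx;
  coords_in (cx e0) => _ E1 E2 E3;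
  (have x00 : x0 = 0 by first [from E1 | from E2 | from E3]); subst x0;
  coords_in (cx e1) => _ F1 F2 F3;
  coords_in (cx e2) => _ G1 G2 G3;
  (have x10 : x1 = 0
     by first [from E2 | from E3 | from F2 | from F3 | from G3]);
  subst x1.
1-7: (have x20 : x2 = 0 by first [from E3 | from F3 | from G3]); subst x2.
- by exists e0, (x3 *: e0); vec4_ring.
- by exists e1, (x3 *: e2); vec4_ring.
- by exists e2, (x3 *: e2); vec4_ring.
- by exists e0, (x3 *: e2); vec4_ring.
- by exists e0, (x3 *: e2); vec4_ring.
- by exists e0, (x3 *: e2); vec4_ring.
- by exists e0, (x3 *: e2); vec4_ring.
- by exists e0, (x2 *: e0 + x3 *: e1); vec4_ring.
- by exists e0, (x2 *: e0 + x3 *: e1); vec4_ring.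
- by all_zero.
1-3: by move/(_ e0 e0) => H; nonzero_product H.
1-2: by all_zero.
- by move/(_ e0 e0 e0) => H; nonzero_product H.
- by all_zero.
- by move/(_ e0 e0 e2) => H; nonzero_product H.
1-5: by move/(_ e0 e0 e0) => H; nonzero_product H.
1-2: by all_zero.
1-5: by all_zero.
- by move/(_ e0 e0 e0 e0) => H; nonzero_product H.
- elim/vec4P=> x0 x1 x2 x3 xx; coords_in xx => _ E1 _ _.
  have x00 : x0 = 0 by apply/eqP; rewrite -sqrf_eq0; apply/eqP; from E1.
  by subst x0; all_zero.
(* In J_{4,3}, a + x b has square 0 but is not central. *)
- have [x x2] := closed_sqrt (-1 : K).
  move/(_ (vec4 1 x 0 0)) => H.
  have {}H : trimul 0 1 0 0 0 1 0 0 0 0 (vec4 1 x 0 0) e0 = 0.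
    by apply: H; rewrite trimulE vec4_0; congr (vec4 _ _ _ _); ring: x2.
  by nonzero_product H.
- move/(_ e1) => H; have {}H : trimul 0 1 0 0 1 0 0 0 0 0 e1 e0 = 0.
    by apply: H; all_zero.
  by nonzero_product H.
- elim/vec4P=> x0 x1 x2 x3 xx; coords_in xx => _ _ E2 E3.
  have /eqP : x0 * x1 = 0 by apply: (mulfI nz2); from E3.
  rewrite mulf_eq0 => /orP[] /eqP x00.
    have x10 : x1 = 0.
      by subst x0; apply/eqP; rewrite -sqrf_eq0; apply/eqP; from E2.
    by subst x0 x1; all_zero.
  have x10 : x0 = 0.
    by subst x1; apply/eqP; rewrite -sqrf_eq0; apply/eqP; from E2.
  by subst x0 x1; all_zero.
- exists e3; elim/vec4P=> x0 x1 x2 x3; elim/vec4P=> y0 y1 y2 y3.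
  by exists (x0 * y0 + x1 * y1 + x2 * y2); vec4_ring.
(* If all products were proportional, the determinant of the (c, d)-coordinates of a^2 and a o b
   would vanish; it is 1. *)
1-2: case; elim/vec4P=> d0 d1 d2 d3 prop;
  have [k] := prop e0 e0; rewrite trimulE vec4Z => /vec4_inj[_ _ E2 E3];
  have [l] := prop e0 e1; rewrite trimulE vec4Z => /vec4_inj[_ _ F2 F3];
  have : (k * d2) * (l * d3) = (k * d3) * (l * d2) by [ring];
  rewrite -{}E2 -{}E3 -{}F2 -{}F3 => E; move/eqP: (oner_neq0 K); apply; from E.
- move/(_ (e1 + e2)) => H.
  have {}H : trimul 1 0 0 0 0 0 0 0 1 0 (e1 + e2) (e1 + e2) = 0.
    by apply: H; rewrite vec4D; all_zero.
  move: H; rewrite vec4D => H; coords_in H => _ _ _ E.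
  by move/eqP: nz2; apply; from E.
- move/(_ e2) => H; have {}H : trimul 1 0 0 0 1 0 0 0 0 1 e2 e2 = 0.
    by apply: H; all_zero.
  by nonzero_product H.
1-3: elim/vec4P=> x0 x1 x2 x3 cx;
  coords_in (cx e0 e0) => _ _ _ E; coords_in (cx e1 e0) => _ _ _ F;
  (have x00 : x0 = 0 by from E); (have x10 : x1 = 0 by from F);
  by subst x0 x1; all_zero.
- move/(_ e0) => H; have {}H : trimul 1 0 0 0 0 0 0 0 1 0 e1 e2 = 0.
    have <- : trimul 1 0 0 0 0 0 0 0 1 0 e0 e0 = e1 by vec4_ring.
    by apply: H; all_zero.
  by nonzero_product H.
- elim/vec4P=> x0 x1 x2 x3 cx; coords_in (cx e0 e0) => _ _ _ E.
  have x00 : x0 = 0 by from E.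
  by subst x0; all_zero.
- move/(_ e1) => H; have {}H : trimul 0 1 0 0 0 1 0 1 0 0 e2 e0 = 0.
    have <- : trimul 0 1 0 0 0 1 0 1 0 0 e1 e1 = e2 by vec4_ring.
    by apply: H; all_zero.
  by nonzero_product H.
(* In J_{4,9} and J_{4,10}, c o x = (x0 + x1) d. If this is 0, then x^2 is a multiple of d, and 0 in
   J_{4,9}. *)
1-3: elim/vec4P=> x0 x1 x2 x3 cx; coords_in (cx e0 e0) => _ _ _ E;
  (have x01 : x0 = - x1 by apply: (addIr x1); from E);
  by subst x0; all_zero.
(* In J_{4,10}, a - b annihilates J^2 but has square -2d. *)
- move/(_ (e0 - e1)); rewrite vec4N vec4D => H.
  have {}H := H ltac:(all_zero).
  by coords_in H => _ _ _ E; move/eqP: nz2; apply; from E.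
Qed.
End InvariantValues.

Theorem theorem37 (K : closedFieldType) (charK : 2%N \notin [pchar K]) :
  [/\ (forall i : 'I_13,
         [/\ is_jordan (J4 K i), is_nilpotent (J4 K i)
           & \dim {: 'rV[K]_4} = 4%N]),
      (forall (J : vectType K) (mul : {bilinear J -> J -> J}),
         is_jordan mul -> is_nilpotent mul -> \dim {: J} = 4%N ->
         exists i : 'I_13, isomorphic mul (J4 K i)),
      (forall i j : 'I_13, isomorphic (J4 K i) (J4 K j) -> i = j)
    & (forall i : 'I_13, has_central_component (J4 K i) <-> (i < 4)%N)].
Proof.
have nz2 : 2%:R != 0 :> K by apply: contra charK => char2; rewrite inE /= char2.
split.
- move=> i; split; [exact: J4_jordan | exact: J4_nilpotent |].
  by rewrite dimvf /dim /= mul1n.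
- move=> J mul jor nilJ dimJ.
  have [i model_i] := nilpotent_classified nz2 jor nilJ dimJ; exists i.
  by apply: modelled_isomorphic model_i => x y; rewrite J4E.
- move=> i j iso_ij; apply/val_inj.
  apply: (invariant_table_separates (ltn_ord i) (ltn_ord j)) => k b inv_i.
  apply/eqP => /(J4_invariant_at nz2); move/(J4_invariant_at nz2): inv_i.
  have [ij ji] := isomorphic_invariant k iso_ij.
  by case: b => /= [/ij | Ni /ji].
- move=> i; split; last exact: J4_central_component.
  (* From the fifth algebra on, invariant 0 holds, which excludes a central component. *)
  move/central_component_notin_square; apply: contra_notT.
  rewrite -leqNgt => i_ge4.
  suff: invariant_at 0 i = Some true by move/(J4_invariant_at nz2).
  by move: i_ge4; case13 i.
Qed.
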